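(* Let $A=\begin{bmatrix}a&b\\ c&d\end{bmatrix}$ be a $2\times2$ quaternionic matrix with $b\neq0$. Then $$Ab^{-1}A=Ab^{-1}a+db^{-1}A+(c-db^{-1}a)I.$$
   Context: $I$ is the $2\times2$ identity matrix. A quaternion $s$ multiplying a matrix on the left or on the right stands for the matrix $sI$; thus $Ab^{-1}A=A(b^{-1}I)A$, $Ab^{-1}a=A(b^{-1}aI)$ and $db^{-1}A=(db^{-1}I)A$. *)

(* Defs.v *)
From HB Require Import structures.
From mathcomp Require Import all_boot all_order all_algebra.
From mathcomp Require Import ring lra.
From mathcomp Require Export reals.

Set Implicit Arguments.
Unset Strict Implicit.
Unset Printing Implicit Defensive.

Import Order.TTheory GRing.Theory Num.Theory.
Local Open Scope ring_scope.

(* Quat x0 x1 x2 x3 is x0 + x1 i + x2 j + x3 k; Hamilton's quaternions are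
   quat R for R : realType. *)
Record quat (R : Type) : Type := Quat { q0 : R; q1 : R; q2 : R; q3 : R }.

Section QuatChoice.
Variable R : Type.

Definition seq_of_quat (x : quat R) : seq R :=
  let: Quat a b c d := x in [:: a; b; c; d].

Definition quat_of_seq (s : seq R) : option (quat R) :=
  if s is [:: a; b; c; d] then Some (Quat a b c d) else None.

Lemma seq_of_quatK : pcancel seq_of_quat quat_of_seq.
Proof. by case. Qed.

End QuatChoice.

HB.instance Definition _ (R : eqType) := Equality.copy (quat R)
  (pcan_type (@seq_of_quatK R)).
HB.instance Definition _ (R : choiceType) := Choice.copy (quat R)
  (pcan_type (@seq_of_quatK R)).

Section QuatRing.
Variable R : realFieldType.
Implicit Types x y z : quat R.

Definition quat_zero : quat R := Quat 0 0 0 0.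
Definition quat_one : quat R := Quat 1 0 0 0.

Definition quat_opp x : quat R :=
  Quat (- q0 x) (- q1 x) (- q2 x) (- q3 x).

Definition quat_add x y : quat R :=
  Quat (q0 x + q0 y) (q1 x + q1 y) (q2 x + q2 y) (q3 x + q3 y).

(* Determined by i^2 = j^2 = k^2 = ijk = -1. *)
Definition quat_mul x y : quat R :=
  Quat (q0 x * q0 y - q1 x * q1 y - q2 x * q2 y - q3 x * q3 y)
       (q0 x * q1 y + q1 x * q0 y + q2 x * q3 y - q3 x * q2 y)
       (q0 x * q2 y - q1 x * q3 y + q2 x * q0 y + q3 x * q1 y)
       (q0 x * q3 y + q1 x * q2 y - q2 x * q1 y + q3 x * q0 y).

Definition quat_sqnorm x : R :=
  q0 x ^+ 2 + q1 x ^+ 2 + q2 x ^+ 2 + q3 x ^+ 2.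

(* The conjugate divided by the squared norm; it sends 0 to 0. *)
Definition quat_inv x : quat R :=
  Quat (q0 x / quat_sqnorm x) (- q1 x / quat_sqnorm x)
       (- q2 x / quat_sqnorm x) (- q3 x / quat_sqnorm x).

Lemma quat_addA : associative quat_add.
Proof. by move=> [? ? ? ?] [? ? ? ?] [? ? ? ?]; rewrite /quat_add /= !addrA. Qed.

Lemma quat_addC : commutative quat_add.
Proof.
by move=> [a b c d] [e f g h]; rewrite /quat_add /=; congr Quat; rewrite addrC.
Qed.

Lemma quat_add0 : left_id quat_zero quat_add.
Proof. by move=> [? ? ? ?]; rewrite /quat_add /= !add0r. Qed.

Lemma quat_addN : left_inverse quat_zero quat_opp quat_add.
Proof. by move=> [? ? ? ?]; rewrite /quat_add /= !addNr. Qed.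

Lemma quat_mulA : associative quat_mul.
Proof.
by move=> [? ? ? ?] [? ? ? ?] [? ? ? ?]; rewrite /quat_mul /=; congr Quat; ring.
Qed.

Lemma quat_mul1q : left_id quat_one quat_mul.
Proof. by move=> [? ? ? ?]; rewrite /quat_mul /=; congr Quat; ring. Qed.

Lemma quat_mulq1 : right_id quat_one quat_mul.
Proof. by move=> [? ? ? ?]; rewrite /quat_mul /=; congr Quat; ring. Qed.

Lemma quat_mulDl : left_distributive quat_mul quat_add.
Proof.
by move=> [? ? ? ?] [? ? ? ?] [? ? ? ?]; rewrite /quat_mul /quat_add /=;
   congr Quat; ring.
Qed.

Lemma quat_mulDr : right_distributive quat_mul quat_add.
Proof.
by move=> [? ? ? ?] [? ? ? ?] [? ? ? ?]; rewrite /quat_mul /quat_add /=;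
   congr Quat; ring.
Qed.

Lemma quat_one_neq0 : quat_one != quat_zero.
Proof. by apply/eqP => -[/eqP]; rewrite oner_eq0. Qed.

Lemma quat_sqnorm_neq0 x : x != quat_zero -> quat_sqnorm x != 0.
Proof.
case: x => a b c d; apply: contraNneq; rewrite /quat_sqnorm /= => /eqP.
rewrite !paddr_eq0 ?addr_ge0 ?sqr_ge0 // !sqrf_eq0.
by move=> /andP[/andP[/andP[/eqP-> /eqP->] /eqP->] /eqP->].
Qed.

End QuatRing.

HB.instance Definition _ (R : realFieldType) :=
  GRing.isZmodule.Build (quat R)
    (@quat_addA R) (@quat_addC R) (@quat_add0 R) (@quat_addN R).
HB.instance Definition _ (R : realFieldType) :=
  GRing.Zmodule_isNzRing.Build (quat R)
    (@quat_mulA R) (@quat_mul1q R) (@quat_mulq1 R)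
    (@quat_mulDl R) (@quat_mulDr R) (@quat_one_neq0 R).

Section QuatUnit.
Variable R : realFieldType.

Definition quat_unit : pred (quat R) := fun x => x != 0.

Lemma quat_mulVq : {in quat_unit, left_inverse 1 (@quat_inv R) *%R}.
Proof.
move=> x /quat_sqnorm_neq0 nz; move: nz.
case: x => a b c d; rewrite /quat_inv /quat_sqnorm /= => nz.
by congr Quat => /=; field.
Qed.

Lemma quat_mulqV : {in quat_unit, right_inverse 1 (@quat_inv R) *%R}.
Proof.
move=> x /quat_sqnorm_neq0 nz; move: nz.
case: x => a b c d; rewrite /quat_inv /quat_sqnorm /= => nz.
by congr Quat => /=; field.
Qed.

Lemma quat_unitP (x y : quat R) : y * x = 1 /\ x * y = 1 -> quat_unit x.
Proof.
move=> [yx1 _]; apply/eqP => x0; move: yx1; rewrite x0 mulr0 => /eqP.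
by rewrite eq_sym oner_eq0.
Qed.

Lemma quat_inv_out : {in [predC quat_unit], @quat_inv R =1 id}.
Proof.
move=> x; rewrite inE negbK => /eqP->.
by congr Quat => /=; rewrite ?oppr0 mul0r.
Qed.

End QuatUnit.

HB.instance Definition _ (R : realFieldType) :=
  GRing.NzRing_hasMulInverse.Build (quat R)
    (@quat_mulVq R) (@quat_mulqV R) (@quat_unitP R) (@quat_inv_out R).

Definition mx22 (T : nzRingType) (a b c d : T) : 'M[T]_2 :=
  \matrix_(i < 2, j < 2) (nth [::] [:: [:: a; b]; [:: c; d]] i)`_j.

(* Main.v *)
Require Import Defs.
From mathcomp Require Import all_boot all_order all_algebra.

Import GRing.Theory.
Local Open Scope ring_scope.

(** A noncommutative Cayley-Hamilton identity, checked entrywise: [b^-1] only ever cancels against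
    an adjacent [b], so nothing has to commute and any ring with [b] invertible will do. *)

Lemma mx22_quadratic (T : unitRingType) (a b c d : T) :
  b \is a GRing.unit ->
  let A := mx22 a b c d in
  A *m (b^-1)%:M *m A =
    A *m (b^-1 * a)%:M + (d * b^-1)%:M *m A + (c - d * b^-1 * a)%:M.
Proof.
move=> ub A; apply/matrixP => i j.
rewrite -!mulmxA !mul_scalar_mx !(mxE, big_ord_recl, big_ord0) /=.
case: i j => [[|[|//]] ?] [[|[|//]] ?];
  rewrite /= ?(mulr1n, mulr0n, mul0r, mulr0, addr0, add0r) !mulrA
    ?mulrV // ?mulrVK // ?mul1r //.
(* Only the diagonal entries remain: in each, [d * b^-1 * a] cancels against the scalar term,
   leaving [c]. *)
- by rewrite -addrA [_ + (c - _)]addrC subrK.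
- by rewrite addrAC [_ + (c - _)]addrC subrK.
Qed.

Theorem corollary6p2 (R : realType) (a b c d : quat R) (hb : b != 0) :
  let A := mx22 a b c d in
  A *m (b^-1)%:M *m A =
    A *m (b^-1 * a)%:M + (d * b^-1)%:M *m A + (c - d * b^-1 * a)%:M.
(* The units of [quat R] are by construction the nonzero quaternions. *)
Proof. by apply: mx22_quadratic; rewrite unfold_in. Qed.
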